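(* Assume $2^{\aleph_0}=2^{\aleph_1}$. Let $X=2^{\omega_1}$ be the Cantor cube, i.e. the product of $\omega_1$ copies of the two-point discrete space $\{0,1\}$, regarded as a compact Hausdorff topological group. Then $X$ is not sequential, $t(X)=\aleph_1$, and $wt(X)=\aleph_0$. In particular $X$ is a homogeneous, non-sequential compact Hausdorff topological group with $wt(X)=\aleph_0<t(X)$.
   Context: For a topological space $X$, the tightness $t(X)$ is the least infinite cardinal $\kappa$ such that whenever $A\subseteq X$ and $x\in\overline{A}$ there is $B\subseteq A$ with $|B|\leq\kappa$ and $x\in\overline{B}$. For a cardinal $\mu$ and $A\subseteq X$, the $\mu$-closure of $A$ is $cl_\mu A=\bigcup\{\overline{B}:B\subseteq A,\ |B|\leq\mu\}$. The weak tightness $wt(X)$ is the least infinite cardinal $\kappa$ for which there is a cover $\mathcal{C}$ of $X$ by subsets of $X$ such that $|\mathcal{C}|\leq 2^\kappa$ and for all $C\in\mathcal{C}$: (a) $t(C)\leq\kappa$ (with $C$ carrying the subspace topology) and (b) $X=cl_{2^\kappa}C$. A space $X$ is homogeneous if for all $x,y\in X$ there is a homeomorphism $h:X\to X$ with $h(x)=y$. A space is sequential if every sequentially closed subset is closed. *)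

(* Defs.v *)
From HB Require Import structures.
From mathcomp Require Import all_boot all_order all_algebra.
From mathcomp Require Import all_classical all_reals all_analysis.
From mathcomp Require wochoice.

Set Implicit Arguments.
Unset Strict Implicit.
Unset Printing Implicit Defensive.

Import GRing.Theory.
Local Open Scope classical_set_scope.
Local Open Scope card_scope.

(* A cardinal is represented by a type K, standing for |K|.  The cardinal     *)
(* functions below are therefore relations: [is_tightness X K] is read        *)
(* "t(X) = |K|".  The power 2^|K| is the cardinal of K -> bool.               *)

Definition card_lt (K L : Type) : Prop :=
  [set: K] #<= [set: L] /\ ~ ([set: L] #<= [set: K]).

Definition least_infinite (P : Type -> Prop) (K : Type) : Prop :=
  [/\ infinite_set [set: K], P K &
      forall L : Type, infinite_set [set: L] -> P L -> [set: K] #<= [set: L]].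

(* The reflexive relation R is a well-order of type omega_1: W is             *)
(* uncountable and all proper initial segments are countable.                 *)
Definition is_omega1 (W : Type) (R : rel W) : Prop :=
  [/\ wochoice.well_order R, ~ countable [set: W] &
      forall w, countable [set v | R v w /\ v <> w]].

Lemma is_omega1_inhabited : exists (W : Type) (R : rel W), is_omega1 R.
Proof.
have [R Rwo] := wochoice.well_ordering_principle (set nat).
have Rmin (A : set (set nat)) : A !=set0 ->
    exists2 m, A m & forall y, A y -> R m y.
  move=> [a Aa]; have [|m [[mA lb] _]] := Rwo [pred x | `[< A x >]].
    by exists a; apply/asboolP.
  exists m; first exact/asboolP/mA.
  by move=> y Ay; apply: lb; apply/asboolP.
have Rxx : reflexive R.
  move=> x; have [|m mx /(_ x erefl)] := Rmin [set x]; first by exists x.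
  by move: mx => /= ->.
have Ranti x y : R x y -> R y x -> x = y.
  move=> Rxy Ryx; have [|z [_ uz]] := Rwo [pred t | (t == x) || (t == y)].
    by exists x; rewrite inE eqxx.
  rewrite -(uz x) ?(uz y) //; split; rewrite ?inE ?eqxx ?orbT //.
    by move=> t; rewrite !inE => /orP[]/eqP->.
  by move=> t; rewrite !inE => /orP[]/eqP->.
pose S := [set x | countable [set y | R y x /\ y <> x]].
pose W := {x : set nat | `[< S x >]}.
exists W, (fun u v => R (val u) (val v)); split.
- move=> A [a Aa].
  have [|_ [w Aw <-] mle] := Rmin [set val w | w in [set w : W | w \in A]].
    by exists (val a), a.
  have wle : {in A, forall x, R (val w) (val x)}.
    by move=> x Ax; apply: mle; exists x.
  exists w; split; first by split.
  move=> v [Av vle]; apply: val_inj; apply: Ranti; first exact: wle.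
  exact: vle.
- move=> cW.
  have cS : countable S.
    have -> : S = (val : W -> set nat) @` [set: W].
      apply/seteqP; split=> [x Sx|_ [w _ <-]]; last exact: asboolW (valP w).
      by exists (exist _ x (asboolT Sx)).
    exact: card_le_trans (card_image_le _ _) cW.
  have [|m nSm mle] := Rmin (~` S).
    apply: contrapT => /nonemptyPn; rewrite -setCT => /setC_inj SE.
    rewrite SE in cS; have /pcard_leTP[f] := cS.
    pose D := [set n | exists2 A, f A = n & ~ A n].
    have [DfD|nDfD] := pselect (D (f D)); last by apply: (nDfD); exists D.
    have [A fA] := DfD; have -> : A = D by apply: (@inj _ _ _ f) => //; exact: in_setT.
    by apply.
  apply: nSm; apply: card_le_trans cS; apply: subset_card_le => y [Rym ym].
  by apply: contrapT => /mle Rmy; apply: ym; apply: Ranti.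
- move=> w; have /asboolW cw := valP w.
  apply: card_le_trans cw.
  apply: (@card_le_trans _ _ _
      ((val : W -> set nat) @` [set v | R (val v) (val w) /\ v <> w])).
    have := @inj_card_eq _ _ [set v | R (val v) (val w) /\ v <> w] (val : W -> set nat).
    by rewrite card_eq_le => /(_ (in2W val_inj))/andP[].
  by apply: subset_card_le => _ [v [Rv nv] <-]; split=> // /val_inj.
Qed.

Definition cantor_cube (W : Type) : Type := {ptws W -> bool}.

(* bool carries the discrete topology and the group law addb, so the group    *)
(* structure on the cube is coordinatewise addition modulo 2.                 *)
HB.instance Definition _ (W : Type) :=
  Topological.copy (cantor_cube W) {ptws W -> bool}.
HB.instance Definition _ (W : Type) :=
  GRing.Zmodule.copy (cantor_cube W) (W -> bool).

Definition is_topological_group (G : PreTopologicalZmodule.type) : Prop :=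
  continuous (fun xy : G * G => (xy.1 + xy.2)%R) /\
  continuous (fun x : G => (- x)%R).

(* The library's [subspace C] keeps all of X as carrier, with the points      *)
(* outside C isolated; here the carrier is C itself.                          *)
Definition subspace_space (X : topologicalType) (C : set X) : topologicalType :=
  initial_topology (set_val : C -> X).

Definition tightness_bound (X : topologicalType) (K : Type) : Prop :=
  forall (A : set X) (x : X), closure A x ->
    exists B : set X, [/\ B `<=` A, B #<= [set: K] & closure B x].

Definition is_tightness (X : topologicalType) (K : Type) : Prop :=
  least_infinite (tightness_bound X) K.

Definition tightness_le (X : topologicalType) (K : Type) : Prop :=
  exists2 L : Type, is_tightness X L & [set: L] #<= [set: K].

Definition card_closure (M : Type) (X : topologicalType) (A : set X) : set X :=
  \bigcup_(B in [set B : set X | B `<=` A /\ B #<= [set: M]]) closure B.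

Definition weak_tightness_bound (X : topologicalType) (K : Type) : Prop :=
  exists CC : set (set X),
    [/\ \bigcup_(C in CC) C = [set: X],
        CC #<= [set: K -> bool] &
        forall C, CC C ->
          tightness_le (subspace_space C) K /\
          card_closure (K -> bool) C = [set: X]].

Definition is_weak_tightness (X : topologicalType) (K : Type) : Prop :=
  least_infinite (weak_tightness_bound X) K.

Definition homeomorphism (X Y : topologicalType) (h : X -> Y) : Prop :=
  continuous h /\
  exists g : Y -> X, [/\ continuous g, cancel h g & cancel g h].

Definition homogeneous (X : topologicalType) : Prop :=
  forall x y : X, exists2 h : X -> X, homeomorphism h & h x = y.

Definition sequentially_closed (X : topologicalType) (A : set X) : Prop :=
  forall (u : nat -> X) (x : X),
    (forall n, A (u n)) -> u @ \oo --> x -> A x.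

Definition sequential (X : topologicalType) : Prop :=
  forall A : set X, sequentially_closed A -> closed A.

(* Main.v *)
Require Import Defs.
From mathcomp Require Import all_boot all_order all_algebra.
From mathcomp Require Import all_classical all_reals all_analysis.
From mathcomp Require wochoice.

Set Implicit Arguments.
Unset Strict Implicit.
Unset Printing Implicit Defensive.

Local Open Scope classical_set_scope.
Local Open Scope card_scope.

(* Everything rests on the Sigma-products, the sets of points that differ from *)
(* a fixed x in countably many coordinates.  They are dense, countably tight   *)
(* (a closing-off argument), and contain the closure of each of their          *)
(* countable subsets.  The last property makes a Sigma-product sequentially    *)
(* closed but not closed, and shows that no countable subset of it has a point *)
(* outside in its closure, so t(X) >= aleph_1; conversely finite subsets of    *)
(* omega_1, of which there are aleph_1, index a neighbourhood base.  As        *)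
(* |X| = 2^aleph_0, the cover of X by all Sigma-products has size 2^aleph_0,   *)
(* and each of them is its own 2^aleph_0-small dense subset: wt(X) = aleph_0.  *)

(** By [closure_cubeP], closure in the cube means agreement on every finite list of coordinates.
    Three facts on Sigma-products then carry the argument: [sigma_product_dense],
    [sigma_product_countable_closure] and [sigma_product_countable_tightness]. The rest is counting:
    omega_1 injects into every uncountable set ([omega1_card_le]) and has only aleph_1 finite
    sequences ([omega1_card_seq]). The equality of powers enters only through [cube_weak_tightness];
    non-sequentiality and the value of the tightness hold without it. *)

Lemma card_le_inj (T U : Type) (B : set U) (f : T -> U) :
  injective f -> (forall x, B (f x)) -> [set: T] #<= B.
Proof.
move=> f_inj fB.
have /card_eqPle[_ leT] := @inj_card_eq _ _ setT f (in2W f_inj).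
by apply: card_le_trans leT _; apply: subset_card_le => _ [x _ <-].
Qed.

(** * Topology and group structure of the cube *)

Lemma cube_cvgP (W : Type) (G : set_system (cantor_cube W))
    (x : cantor_cube W) :
  Filter G -> G --> x <-> forall w, G [set y | y w = x w].
Proof.
move=> FG; rewrite cvg_sup; split=> Gx w.
  apply: (Gx w); exists [set y | y w = x w]; split=> //.
  exists [set x w]; first exact: discrete_open.
  by [].
move=> U [_ [[V _ <-] Vx VU]].
by apply: filterS (Gx w) => y /= yx; apply: VU; rewrite /= yx.
Qed.

Definition cylinder (W : Type) (x : cantor_cube W) (F : seq W) :
  set (cantor_cube W) := [set y | all (fun w => y w == x w) F].

Lemma nbhs_cylinder (W : Type) (x : cantor_cube W) F : nbhs x (cylinder x F).
Proof.
have /cube_cvgP x_cvg : nbhs x --> x by exact: cvg_id.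
elim: F => [|w F IHF]; first exact: filterS filterT.
by apply: filterS2 (x_cvg w) IHF => y /= yx yF; rewrite /cylinder /= yx eqxx.
Qed.

Lemma cylinder_base (W : Type) (x : cantor_cube W) U :
  nbhs x U -> exists F, cylinder x F `<=` U.
Proof.
pose G := filter_from [set: seq W] (cylinder x).
have FG : Filter G.
  apply: filter_from_filter => [|F1 F2 _ _]; first by exists [::].
  by exists (F1 ++ F2) => // y; rewrite /cylinder /= all_cat => /andP.
suff: G --> x by move=> /[apply] -[F _ FU]; exists F.
apply/cube_cvgP => w; exists [:: w] => // y.
by rewrite /cylinder /= andbT => /eqP.
Qed.

Lemma closure_cubeP (W : Type) (A : set (cantor_cube W)) x :
  closure A x <-> forall F, exists2 a, A a & cylinder x F a.
Proof.
split=> [Ax F|Ax U /cylinder_base[F FU]].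
  by have [a [Aa Fa]] := Ax _ (nbhs_cylinder x F); exists a.
by have [a Aa Fa] := Ax F; exists a; split=> //; apply: FU.
Qed.

Lemma cube_topological_group (W : Type) : is_topological_group (cantor_cube W).
Proof.
split.
  move=> [x y]; apply/cube_cvgP => w /=.
  have nbhs_coord (z : cantor_cube W) :
      nbhs z [set u : cantor_cube W | u w = z w].
    by have /cube_cvgP : nbhs z --> z by exact: cvg_id.
  exists ([set u | u w = x w], [set u | u w = y w]) => [|[u v] [/= ux vy]].
    by split; exact: nbhs_coord.
  by rewrite -[LHS]/(u w (+) v w) ux vy.
move=> x; apply/cube_cvgP => w.
have /cube_cvgP/(_ w) : nbhs x --> x by exact: cvg_id.
exact.
Qed.

Lemma cube_homogeneous (W : Type) : homogeneous (cantor_cube W).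
Proof.
have cont (a : cantor_cube W) : continuous (fun z => a + z)%R.
  have [addC _] := cube_topological_group W; move=> z.
  exact: (cvg_comp _ _ (cvg_pair (cvg_cst a) cvg_id) (addC (a, z))).
move=> x y; exists (fun z => (y - x) + z)%R; last by rewrite GRing.subrK.
split; first exact: cont.
exists (fun z => - (y - x) + z)%R; split; first exact: cont.
- exact: GRing.addKr.
- exact: GRing.addNKr.
Qed.

Lemma cube_compact (W : Type) : compact [set: cantor_cube W].
Proof.
(* Products are indexed by an eqType; classically every type is one. *)
elim/Peq: W => W.
have := @tychonoff W (fun _ => bool) _ (fun=> bool_compact).
by congr (compact _); rewrite eqEsubset.
Qed.

Lemma cube_hausdorff (W : Type) : hausdorff_space (cantor_cube W).
Proof.
elim/Peq: W => W; apply: hausdorff_product => ?.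
exact: discrete_hausdorff.
Qed.

(** * Cardinal arithmetic of omega_1 *)

Lemma countableU (T : Type) (A B : set T) :
  countable A -> countable B -> countable (A `|` B).
Proof.
by move=> cA cB; rewrite -bigcup2E; apply: bigcup_countable => // -[|[|n]] _ /=.
Qed.

Section WellFoundedEmbedding.
Variables (I T : Type) (lt : I -> I -> Prop) (A : set T).
Hypotheses (lt_wf : well_founded lt)
  (lt_total : forall i j, i = j \/ lt i j \/ lt j i)
  (lt_countable : forall i, countable [set j | lt j i])
  (A_uncountable : ~ countable A).

(** Transfinite recursion: the values already chosen below [i] form a countable set, so the
    uncountable [A] has a fresh element to give to [i]. Totality of [lt] makes the resulting map
    injective. *)
Lemma wf_card_le : [set: I] #<= A.
Proof.
have fresh i (f : forall j, lt j i -> T) :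
    exists t, A t /\ forall j (ji : lt j i), t <> f j ji.
  apply: contrapT => no_t; apply: A_uncountable.
  have [t0 _] : A !=set0.
    by apply/set0P/eqP => A0; apply: A_uncountable; rewrite A0.
  (* The default [t0] extends [f] to a total function, so that its values are the image of a
     countable segment. *)
  pose g j := if pselect (lt j i) is left ji then f j ji else t0.
  apply: sub_countable (card_le_trans (card_image_le g _) (lt_countable i)).
  apply: subset_card_le => t At; apply: contrapT => gt; apply: no_t.
  exists t; split=> // j ji tE; apply: gt; exists j => //.
  rewrite /g; case: pselect => // ji'.
  by rewrite tE; congr f; exact: Prop_irrelevance.
pose step i f := projT1 (cid (fresh i f)).
pose h := Fix lt_wf (fun=> T) step.
have hE i : h i = step i (fun j _ => h j).
  apply: (Fix_eq lt_wf (fun=> T) step) => {}i f g fg.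
  congr step; apply: functional_extensionality_dep => j.
  by apply: functional_extensionality_dep => ji; exact: fg.
have hP i : A (h i) /\ forall j, lt j i -> h i <> h j.
  by rewrite hE /step; case: cid => t [At tP]; split=> // j ji; exact: tP.
apply: (@card_le_inj _ _ _ h) => [i j hij|i]; last exact: (hP i).1.
have [//|[ij|ji]] := lt_total i j; first by case: ((hP j).2 i ij).
by case: ((hP i).2 j ji).
Qed.

End WellFoundedEmbedding.

Lemma well_order_total (T : Type) (R : rel T) :
  wochoice.well_order R -> total R.
Proof.
elim/Peq: T R => T R Rwo v w.
exact: (@wochoice.wo_chainW _ R predT (fun A _ => Rwo A)).
Qed.

Lemma well_order_antisymmetric (T : Type) (R : rel T) :
  wochoice.well_order R -> antisymmetric R.
Proof.
elim/Peq: T R => T R Rwo v w.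
exact: (@wochoice.wo_chain_antisymmetric _ R predT (fun A _ => Rwo A)).
Qed.

Section Omega1.
Variables (W : Type) (R : rel W).
Hypothesis omega1W : is_omega1 R.

Let lt (v w : W) : Prop := R v w /\ v <> w.

Let lt_wf : well_founded lt.
Proof.
have [Rwo _ _] := omega1W; move=> w; apply: contrapT => nAw.
have [|m [[/asboolP nAm lb] _]] := Rwo [pred v | `[< ~ Acc lt v >]].
  by exists w; apply/asboolP.
apply: nAm; constructor=> v [Rvm vm]; apply: contrapT => nAv; apply: vm.
apply: (well_order_antisymmetric Rwo); rewrite Rvm.
by apply: lb; apply/asboolP.
Qed.

Let R_total : total R.
Proof. by have [+ _ _] := omega1W; exact: well_order_total. Qed.

Let lt_total v w : v = w \/ lt v w \/ lt w v.
Proof.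
have [->|vw] := pselect (v = w); [by left|right].
by have /orP[Rvw|Rwv] := R_total v w; [left|right; split=> // /esym].
Qed.

Let lt_countable w : countable [set v | lt v w].
Proof. by have [_ _] := omega1W; apply. Qed.

Lemma omega1_card_le (T : Type) (A : set T) :
  ~ countable A -> [set: W] #<= A.
Proof. exact: wf_card_le. Qed.

Let lexlt (p q : W * nat) : Prop :=
  lt p.1 q.1 \/ p.1 = q.1 /\ (p.2 < q.2)%N.

(** The lexicographic order on [W * nat] is again well-founded and total with countable initial
    segments, so [wf_card_le] applies to it. *)
Lemma omega1_card_X_nat : [set: W * nat] #<= [set: W].
Proof.
apply: (@wf_card_le _ _ lexlt); last by have [] := omega1W.
- case=> w; elim/(well_founded_ind lt_wf): w => w IHw n.
  elim/ltn_ind: n => n IHn; constructor=> -[v m] [/= vw|[/= -> mn]].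
    exact: IHw.
  exact: IHn.
- move=> [v m] [w n]; have [->|[vw|wv]] := lt_total v w.
  + have [mn|nm|->] := ltngtP m n; last by left.
      by right; left; right.
    by right; right; right.
  + by right; left; left.
  + by right; right; left.
- move=> [w n].
  have cX : countable (([set v | lt v w] `|` [set w]) `*` [set: nat]).
    by apply: countableX => //; exact: countableU.
  apply: sub_countable cX; apply: subset_card_le.
  by move=> [v m] [/= vw|[/= -> _]]; split=> //; [left|right].
Qed.

Let R_countable w : countable [set v | R v w].
Proof.
apply: sub_countable (countableU (lt_countable w) (countable1 w)).
apply: subset_card_le => v Rvw.
by have [->|vw] := pselect (v = w); [right|left].
Qed.

(** An [m] that fails to bound [F] lies strictly below some entry, which leaves only countably many
    such [m]. *)
Lemma omega1_seq_bounded (F : seq W) : exists m, all (R^~ m) F.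
Proof.
suff cF : countable [set m | ~~ all (R^~ m) F].
  have [_ cW _] := omega1W; apply: contrapT => nF; apply: cW.
  apply: sub_countable cF; apply: subset_card_le => m _ /=.
  by apply/negP => mF; apply: nF; exists m.
elim: F => [|w F IHF] /=.
  by rewrite (_ : mkset _ = set0) // -subset0.
apply: sub_countable (countableU (lt_countable w) IHF).
apply: subset_card_le => m /=; rewrite negb_and => /orP[wm|]; last by right.
left; split; first by have := R_total m w; rewrite (negbTE wm) orbF.
by move=> mw; move: wm; rewrite mw; have := R_total w w; rewrite orbb => ->.
Qed.

(** A sequence is coded by a bound [m] and the list of naturals that its entries become under a
    fixed injection of the countable segment below [m]. Sequences with equal codes share the bound,
    hence the injection. *)
Lemma omega1_card_seq : [set: seq W] #<= [set: W].
Proof.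
apply: card_le_trans omega1_card_X_nat.
have code w : exists c : W -> nat, {in [set v | R v w] &, injective c}.
  exact/countable_injP.
pose m F := projT1 (cid (omega1_seq_bounded F)).
pose c w := projT1 (cid (code w)).
pose h F := (m F, pickle [seq c (m F) v | v <- F]).
apply: (@card_le_inj _ _ _ h) => //.
move=> F1 F2 [mE].
have := projT2 (cid (omega1_seq_bounded F2)).
have := projT2 (cid (omega1_seq_bounded F1)); rewrite -!/(m _) -mE.
move=> F1m F2m /(pcan_inj pickleK).
have := projT2 (cid (code (m F1))); rewrite -/(c _) => c_inj.
move: F1m F2m c_inj {mE}; move: (c (m F1)) => f.
move: (m F1) => b F1b F2b f_inj; elim: F1 F2 F1b F2b => [|v F1 IH] [|w F2] //=.
move=> /andP[vb F1b] /andP[wb F2b] [fE FE].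
by congr cons; [apply: f_inj; rewrite ?inE|exact: IH FE].
Qed.

End Omega1.

(** * Sigma-products *)

Definition sigma_product (W : Type) (x : cantor_cube W) : set (cantor_cube W) :=
  [set y | countable [set w | y w <> x w]].

Lemma sigma_product_center (W : Type) (x : cantor_cube W) : sigma_product x x.
Proof. by apply: sub_countable (countable0 W); apply: subset_card_le. Qed.

Lemma sigma_product_dense (W : Type) (x : cantor_cube W) :
  closure (sigma_product x) = [set: cantor_cube W].
Proof.
apply/seteqP; split=> // y _; apply/closure_cubeP => F.
have [a [aF ax]] : exists a : cantor_cube W,
    cylinder y F a /\ sigma_product x a.
  elim: F => [|w F [a [Fa ax]]].
    by exists x; split=> //; exact: sigma_product_center.
  exists (fun v => if `[< v = w >] then y w else a v); split.
    rewrite /cylinder /= asboolT // eqxx /=; apply: sub_all Fa => v /eqP av.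
    by case: asboolP => [->|_]; rewrite ?av.
  apply: sub_countable (countableU (countable1 w) ax); apply: subset_card_le.
  by move=> v /=; case: asboolP => [->|_]; [left|right].
by exists a.
Qed.

(** Where [y] differs from [x], some [b] in [B] agrees with [y] and so differs from [x] too; the
    support of [y] lies in a countable union of countable supports. *)
Lemma sigma_product_countable_closure (W : Type) (x : cantor_cube W) B :
  countable B -> B `<=` sigma_product x -> closure B `<=` sigma_product x.
Proof.
move=> cB Bx y /closure_cubeP By.
pose D (b : cantor_cube W) := [set w | b w <> x w].
apply: sub_countable (bigcup_countable (F := D) cB Bx).
apply: subset_card_le => w /= yx; have [b Bb] := By [:: w].
by rewrite /cylinder /= andbT => /eqP bw; exists b => //; rewrite /D /= bw.
Qed.

(** For each [F] pick [f F] in [A] agreeing with [x] on [F], and close a countable set of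
    coordinates under taking supports of these points. Given any [F], the point picked for the part
    of [F] inside that set agrees with [x] there by choice, and outside because its support stays
    inside. *)
Lemma sigma_product_countable_tightness (W : Type) (x : cantor_cube W) A :
  A `<=` sigma_product x -> closure A x ->
  exists B, [/\ B `<=` A, countable B & closure B x].
Proof.
elim/Pchoice: W x A => W x A Ax /closure_cubeP clA.
(* With no coordinates the cube is a single point; otherwise [w0] seeds the closing-off. *)
have [[w0]|nW] := pselect (inhabited W); last first.
  have [a Aa _] := clA [::].
  exists [set a]; split; [by move=> _ ->|exact: countable1|].
  have -> : x = a by apply/funext => w; case: nW.
  exact: subset_closure.
have enum F : exists fe : cantor_cube W * (nat -> W),
    [/\ A fe.1, cylinder x F fe.1 &
        [set w | fe.1 w <> x w] `<=` range fe.2].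
  have [a Aa Fa] := clA F.
  have /countable_injP[c c_inj] := Ax _ Aa.
  exists (a, fun n => xget w0 [set w | a w <> x w /\ c w = n]); split=> // w aw.
  have wP : exists v, [set v | a v <> x v /\ c v = c w] v by exists w.
  have [av cv] := xgetPex w0 wP.
  by exists (c w) => //; apply: c_inj; rewrite ?inE.
pose f F := (projT1 (cid (enum F))).1; pose e F := (projT1 (cid (enum F))).2.
have fP F : [/\ A (f F), cylinder x F (f F) &
    [set w | f F w <> x w] `<=` range (e F)].
  exact: (projT2 (cid (enum F))).
(* The range of phi is closed under F |-> support of f F - x, and countable *)
(* because trees are.                                                       *)
pose fix phi (t : GenTree.tree nat) : W :=
  if t is GenTree.Node n ts then e (map phi ts) n else w0.
have phi_node ts : [set w | f (map phi ts) w <> x w] `<=` range phi.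
  have [_ _ fe] := fP (map phi ts).
  by move=> w /fe[n _ <-]; exists (GenTree.Node n ts).
exists (range (fun ts => f (map phi ts))); split.
- by move=> _ [ts _ <-]; have [] := fP (map phi ts).
- exact: card_le_trans (card_image_le _ _) (countableP _).
- apply/closure_cubeP => F.
  have [ts tsE] : exists ts, map phi ts = [seq w <- F | `[< range phi w >]].
    elim: F => [|w F [ts IH]] /=; first by exists [::].
    case: asboolP => [[t _ <-]|_]; last by exists ts.
    by exists (t :: ts); rewrite /= IH.
  exists (f (map phi ts)); first by exists ts.
  have [_ + _] := fP (map phi ts).
  rewrite /cylinder /= {2}tsE all_filter; apply: sub_all => w /=.
  case: (asboolP (range phi w)) => //= nw _.
  by apply/eqP; apply: contrapT => /phi_node.
Qed.

Lemma subspace_closureP (X : topologicalType) (C : set X)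
    (A : set (subspace_space C)) (p : subspace_space C) :
  closure A p <-> closure (set_val @` (A : set C)) (set_val (p : C)).
Proof.
pose val_C : C -> X := set_val.
split=> [Ap U /(initial_continuous (f := val_C) (x := p)) /= pU|Ap U].
  by have [a [Aa Ua]] := Ap _ pU; exists (set_val (a : C)); split.
move=> [_ [[V Vo <-] Vp VU]].
have [_ [[a Aa <-] Va]] := Ap _ (open_nbhs_nbhs (conj Vo Vp)).
by exists a; split=> //; exact: VU.
Qed.

(** Countable tightness was shown only at the centre, but a Sigma-product can be recentred at any of
    its points [p]: a point differing countably often from [x] does so from [p]. *)
Lemma sigma_product_tightness (W : Type) (x : cantor_cube W) :
  is_tightness (subspace_space (sigma_product x)) nat.
Proof.
split; [exact: infinite_nat| |by move=> L /infiniteP].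
pose val_x : sigma_product x -> cantor_cube W := set_val.
move=> A p /subspace_closureP clA.
have pP : sigma_product x (val_x p) by exact: set_valP.
have [|B [BA cB clB]] := sigma_product_countable_tightness _ clA.
  move=> _ [a Aa <-].
  apply: sub_countable (countableU pP (set_valP (a : sigma_product x))).
  apply: subset_card_le => w /= ap.
  have [px|] := pselect (val_x p w = x w); [right|by left].
  by rewrite -px.
have imB : val_x @` (A `&` val_x @^-1` B) = B.
  apply/seteqP; split=> [_ [a [_ Ba] <-]//|b Bb].
  have [a Aa ab] := BA _ Bb; exists a => //; split=> //.
  by rewrite /preimage /= [val_x a]ab.
exists (A `&` val_x @^-1` B); split; first by move=> a [].
  apply: card_le_trans cB; rewrite -[X in _ #<= X]imB.
  have val_x_inj : {in A `&` val_x @^-1` B &, injective val_x}.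
    exact: in2W val_inj.
  by have /card_eqPle[] := inj_card_eq val_x_inj.
by apply/subspace_closureP; rewrite [image _ _]imB.
Qed.

(** The cardinal bound serves twice: it limits the number of Sigma-products, which are indexed by
    points, and lets each one be its own small dense subset. *)
Lemma cube_weak_tightness (W : Type) :
  [set: W -> bool] #<= [set: nat -> bool] ->
  is_weak_tightness (cantor_cube W) nat.
Proof.
move=> leW; split; [exact: infinite_nat| |by move=> L /infiniteP].
exists (range (@sigma_product W)); split.
- apply/seteqP; split=> // x _; exists (sigma_product x); first by exists x.
  exact: sigma_product_center.
- exact: card_le_trans (card_image_le _ _) leW.
- move=> _ [x _ <-]; split.
    by exists nat; [exact: sigma_product_tightness|exact: card_lexx].
  apply/seteqP; split=> // y _; exists (sigma_product x).
    by split=> //; exact: card_le_trans (card_leT _) leW.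
  by rewrite sigma_product_dense.
Qed.

(** * Non-sequentiality and tightness for omega_1 coordinates *)

Section Omega1Cube.
Variables (W : Type) (R : rel W).
Hypothesis omega1W : is_omega1 R.

Let x0 : cantor_cube W := fun=> false.
Let x1 : cantor_cube W := fun=> true.

Let x1_notin : ~ sigma_product x0 x1.
Proof.
have [_ + _] := omega1W; apply: contra_not; apply: sub_countable.
by apply: subset_card_le => w _ /=.
Qed.

Let closure_x1 : closure (sigma_product x0) x1.
Proof. by rewrite sigma_product_dense. Qed.

Lemma cube_not_sequential : ~ sequential (cantor_cube W).
Proof.
move=> /(_ (sigma_product x0)) seqX; apply: x1_notin.
apply: (seqX _) closure_x1 => u x u_sigma ux.
apply: (sigma_product_countable_closure (B := range u)).
- exact: card_le_trans (card_image_le _ _) (countableP _).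
- by move=> _ [n _ <-].
- move=> U /ux [N _ NU]; exists (u N); split; first by exists N.
  by apply: NU => /=.
Qed.

Lemma cube_tightness : is_tightness (cantor_cube W) W.
Proof.
have [_ W_uncountable _] := omega1W; split.
- by move=> /finite_set_countable.
- move=> A x /closure_cubeP clA; pose f F := projT1 (cid2 (clA F)).
  exists (range f); split.
  + by move=> _ [F _ <-]; rewrite /f; case: cid2.
  + exact: card_le_trans (card_image_le _ _) (omega1_card_seq omega1W).
  + apply/closure_cubeP => F; exists (f F); first by exists F.
    by rewrite /f; case: cid2.
(* A countable [B] inside the Sigma-product could not reach [x1], so [B] is uncountable and omega_1
   injects into it. *)
- move=> L _ /(_ _ _ closure_x1)[B [Bx0 BL clB]].
  apply: card_le_trans BL; apply: (omega1_card_le omega1W) => cB.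
  apply: x1_notin.
  exact: sigma_product_countable_closure clB.
Qed.

End Omega1Cube.

Theorem mainTheorem1 (W : Type) (R : rel W) (omega1W : is_omega1 R)
    (pow_omega : [set: nat -> bool] #= [set: W -> bool]) :
  [/\ ~ sequential (cantor_cube W),
      is_tightness (cantor_cube W) W,
      is_weak_tightness (cantor_cube W) nat &
      [/\ homogeneous (cantor_cube W),
          compact [set: cantor_cube W],
          hausdorff_space (cantor_cube W),
          is_topological_group (cantor_cube W) &
          forall K L : Type,
            is_weak_tightness (cantor_cube W) K ->
            is_tightness (cantor_cube W) L ->
            card_lt K L]].
Proof.
have tW := cube_tightness omega1W.
have wtN : is_weak_tightness (cantor_cube W) nat.
  by apply: cube_weak_tightness; have /card_eqPle[] := pow_omega.
split=> //; first exact: cube_not_sequential omega1W.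
split; [exact: cube_homogeneous|exact: cube_compact|exact: cube_hausdorff
  |exact: cube_topological_group|].
move=> K L [_ _ K_le] [L_infinite L_bound _].
have [N_infinite N_bound _] := wtN; have [_ _ W_le] := tW.
have KN : [set: K] #<= [set: nat] by exact: K_le.
split; first by apply: card_le_trans KN _; exact/infiniteP.
(* Otherwise [W] would inject into [L], then [K], then [nat]. *)
move=> LK; have [_ + _] := omega1W; apply.
exact: card_le_trans (W_le _ L_infinite L_bound) (card_le_trans LK KN).
Qed.
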